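(* Let $h$ and $d$ be integers with $h \geq 1$ and $d \geq 3$. Then there exists an integral convex polytope of dimension $d$ which is very ample, is not normal, and has exactly $h$ holes.
   Context: An integral convex polytope is a convex polytope $\mathcal{P} \subset \mathbb{R}^N$ all of whose vertices lie in $\mathbb{Z}^N$. Let $\widetilde{\mathcal{P}} \subset \mathbb{R}^{N+1}$ be the convex hull of the points $(\alpha,1)$ with $\alpha \in \mathcal{P}$, and let $\mathcal{A}_{\mathcal{P}} = \widetilde{\mathcal{P}} \cap \mathbb{Z}^{N+1}$. Write $\mathbb{R}_{\geq 0}\mathcal{A}_{\mathcal{P}}$, $\mathbb{Z}\mathcal{A}_{\mathcal{P}}$, $\mathbb{Z}_{\geq 0}\mathcal{A}_{\mathcal{P}}$ for the sets of all finite linear combinations of elements of $\mathcal{A}_{\mathcal{P}}$ with coefficients in $\mathbb{R}_{\ge 0}$, $\mathbb{Z}$, $\mathbb{Z}_{\ge 0}$, respectively. The polytope $\mathcal{P}$ is normal if $\mathbb{R}_{\geq 0}\mathcal{A}_{\mathcal{P}} \cap \mathbb{Z}\mathcal{A}_{\mathcal{P}} = \mathbb{Z}_{\geq 0}\mathcal{A}_{\mathcal{P}}$. It is very ample if the set $(\mathbb{R}_{\geq 0}\mathcal{A}_{\mathcal{P}} \cap \mathbb{Z}\mathcal{A}_{\mathcal{P}}) \setminus \mathbb{Z}_{\geq 0}\mathcal{A}_{\mathcal{P}}$ is finite; the elements of this set are called the holes of $\mathcal{P}$. *)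

(* Defs.v *)
From HB Require Import structures.
From mathcomp Require Export all_boot all_order all_algebra archimedean.
From mathcomp Require Export boolp classical_sets cardinality reals convex.

Set Implicit Arguments.
Unset Strict Implicit.
Unset Printing Implicit Defensive.

Import Order.TTheory GRing.Theory Num.Theory.

Local Open Scope classical_set_scope.
Local Open Scope ring_scope.

Section Hulls.
Context {R : realType} {N : nat}.
Implicit Types (S : set R) (A P : set 'rV[R]_N).

Definition convex_hull A : set 'rV[R]_N := smallest (@convex_set R 'rV[R]_N) A.

(* The family [a] may repeat elements of [A]; this gives the same set as
   combinations of distinct elements whenever [S] is closed under addition. *)
Definition combinations S A : set 'rV[R]_N :=
  [set x | exists (k : nat) (a : 'I_k -> 'rV[R]_N) (c : 'I_k -> R),
    [/\ forall i, A (a i), forall i, S (c i)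
      & x = \sum_(i < k) c i *: a i]].

Definition affine_hull A : set 'rV[R]_N :=
  [set x | exists (k : nat) (a : 'I_k -> 'rV[R]_N) (c : 'I_k -> R),
    [/\ forall i, A (a i), \sum_(i < k) c i = 1
      & x = \sum_(i < k) c i *: a i]].

Definition has_dimension P (d : nat) : Prop :=
  exists (x0 : 'rV[R]_N) (U : {vspace 'rV[R]_N}),
    \dim U = d /\ affine_hull P = [set x0 + u | u in [set` U]].

Definition polytope P : Prop :=
  exists V : set 'rV[R]_N, finite_set V /\ P = convex_hull V.

(* The vertices of a convex polytope are its extreme points. *)
Definition vertices P : set 'rV[R]_N :=
  [set v | P v /\
    forall (x y : 'rV[R]_N) (t : R), P x -> P y -> 0 < t < 1 ->
      v = t *: x + (1 - t) *: y -> x = v /\ y = v].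

Definition integer_points : set 'rV[R]_N :=
  [set x : 'rV[R]_N | forall j, x ord0 j \is a Num.int].

Definition integral_convex_polytope P : Prop :=
  polytope P /\ vertices P `<=` integer_points.

End Hulls.

Section Holes.
Context {R : realType} {N : nat}.
Implicit Types (P : set 'rV[R]_N).

Definition lift_polytope P : set 'rV[R]_(N + 1) :=
  convex_hull [set row_mx a (const_mx 1) | a in P].

Definition lattice_gens P : set 'rV[R]_(N + 1) :=
  lift_polytope P `&` integer_points.

Definition cone_gens P := combinations [set c : R | 0 <= c] (lattice_gens P).

Definition group_gens P :=
  combinations [set c : R | c \is a Num.int] (lattice_gens P).

Definition monoid_gens P :=
  combinations [set c : R | c \is a Num.nat] (lattice_gens P).

Definition normal_polytope P : Prop :=
  cone_gens P `&` group_gens P = monoid_gens P.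

Definition holes P : set 'rV[R]_(N + 1) :=
  (cone_gens P `&` group_gens P) `\` monoid_gens P.

Definition very_ample P : Prop := finite_set (holes P).

End Holes.

(* Main.v *)
Require Import Defs.
From mathcomp Require Import interval_inference zify ring lra.

(** Over the unit square take four lattice segments of length [h], starting at
    height [0] over [(0,0)], [(1,0)], [(0,1)] and at height [k = 3h+1] over
    [(1,1)], and in dimension [d > 3] add [d-3] apexes to the base, each
    carrying a segment [[0,h]].  Over a base point [(a,b,c)] in degree [n], with
    [s = n - \sum c], the monoid consists of the heights in the union of the
    intervals [[kj, kj+hn]], where [j], the number of summands over [(1,1)],
    ranges over [max(0,a+b-s) <= j <= min(a,b)], while the cone fills the whole
    span of this union.  For [n >= 3] consecutive intervals leave no integer
    between them, and for [n <= 2] the only [j]-range with more than one element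
    is [{0,1}], over [(1,1,0)] in degree 2; there the integers strictly between
    [2h] and [3h+1] are missed, giving exactly [h] holes. *)

Set Implicit Arguments.
Unset Strict Implicit.
Unset Printing Implicit Defensive.

Import Order.TTheory GRing.Theory Num.Theory.

Local Open Scope classical_set_scope.
Local Open Scope ring_scope.

(** * Convex hulls and extreme points *)

Section ConvexHull.
Context {R : realType} {N : nat}.
Implicit Types (A C P : set 'rV[R]_N).

Lemma convex_setP C : @convex_set R 'rV[R]_N C <->
  forall x y (t : R), C x -> C y -> 0 <= t <= 1 -> C (t *: x + (1 - t) *: y).
Proof.
split=> [cC x y t Cx Cy /andP[t0 t1]|cC x y t].
  have := cC x y (Itv01 t0 t1); rewrite !inE; exact.
rewrite !inE => Cx Cy.
by apply: (cC x y t%:inum) => //; apply/andP; split.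
Qed.

Lemma sub_convex_hull A : A `<=` convex_hull A.
Proof. exact: sub_gen_smallest. Qed.

Lemma convex_hull_sub A C :
  (forall x y (t : R), C x -> C y -> 0 <= t <= 1 ->
     C (t *: x + (1 - t) *: y)) ->
  A `<=` C -> convex_hull A `<=` C.
Proof. by move=> /convex_setP cC AC; apply: smallest_sub. Qed.

Lemma convex_hull_conv A (x y : 'rV[R]_N) (t : R) :
  convex_hull A x -> convex_hull A y -> 0 <= t <= 1 ->
  convex_hull A (t *: x + (1 - t) *: y).
Proof.
move=> Ax Ay t01 C [/= cC AC].
by move/convex_setP: (cC); apply=> //; [exact: Ax|exact: Ay].
Qed.

(* If an extreme point [v] were outside [A], removing it from the hull would
   leave a convex set containing [A]. *)
Lemma vertices_convex_hull A : vertices (convex_hull A) `<=` A.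
Proof.
move=> v [Pv ext]; apply: contrapT => nAv.
pose C := [set x | convex_hull A x /\ x <> v].
have : convex_hull A `<=` C.
  apply: convex_hull_sub => [x y t [Px xv] [Py yv] /andP[t0 t1]|x Ax].
    split; first by apply: convex_hull_conv => //; rewrite t0.
    move=> /esym vE; have [t00|tn0] := eqVneq t 0.
      by apply: yv; rewrite vE t00 scale0r add0r subr0 scale1r.
    have [t11|tn1] := eqVneq t 1.
      by apply: xv; rewrite vE t11 subrr scale0r addr0 scale1r.
    have t01 : 0 < t < 1 by rewrite !lt_neqAle eq_sym tn0 t0 tn1 t1.
    by have [] := ext _ _ _ Px Py t01 vE.
  split; first exact: sub_convex_hull.
  by move=> xv; apply: nAv; rewrite -xv.
by move=> /(_ v Pv) [].
Qed.

End ConvexHull.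

(** * Cones, groups and monoids as sets of combinations *)

Section Combinations.
Context {R : realType} {N : nat}.
Implicit Types (S : set R) (A B : set 'rV[R]_N).

Lemma combinations0 S A : combinations S A 0.
Proof.
exists 0%N, (fun=> 0), (fun=> 0).
by split; [case | case | rewrite big_ord0].
Qed.

Lemma combinationsZ S A c a : S c -> A a -> combinations S A (c *: a).
Proof.
move=> Sc Aa; exists 1%N, (fun=> a), (fun=> c).
by split=> //; rewrite big_ord1.
Qed.

Lemma combinationsD S A x y :
  combinations S A x -> combinations S A y -> combinations S A (x + y).
Proof.
move=> [k1 [a1 [c1 [Aa1 Sc1 ->]]]] [k2 [a2 [c2 [Aa2 Sc2 ->]]]].
exists (k1 + k2)%N,
  (fun i => match split i with inl j => a1 j | inr j => a2 j end),
  (fun i => match split i with inl j => c1 j | inr j => c2 j end).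
split=> [i|i|]; [by case: split | by case: split |].
rewrite big_split_ord /=.
by congr (_ + _); apply: eq_bigr => i _;
  [rewrite (unsplitK (inl i))|rewrite (unsplitK (inr i))].
Qed.

Lemma combinations_ind S A B :
  B 0 -> (forall x y, B x -> B y -> B (x + y)) ->
  (forall c a, S c -> A a -> B (c *: a)) -> combinations S A `<=` B.
Proof.
move=> B0 BD BZ _ [k [a [c [Aa Sc ->]]]].
by apply: (big_ind B) => // i _; apply: BZ.
Qed.

Lemma combinations_nat_sub A B :
  B 0 -> (forall x y, B x -> B y -> B (x + y)) -> A `<=` B ->
  combinations [set c : R | c \is a Num.nat] A `<=` B.
Proof.
move=> B0 BD AB; apply: combinations_ind => // c a /natrP[n ->] /AB Ba.
rewrite scaler_nat; elim: n => [|n IHn]; first by rewrite mulr0n.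
by rewrite mulrS; apply: BD.
Qed.

Lemma integer_pointsD (x y : 'rV[R]_N) :
  integer_points x -> integer_points y -> integer_points (x + y).
Proof. by move=> ix iy j; rewrite mxE rpredD. Qed.

Lemma combinations_int_sub A : A `<=` integer_points ->
  combinations [set c : R | c \is a Num.int] A `<=` integer_points.
Proof.
move=> iA; apply: combinations_ind.
- by move=> j; rewrite mxE rpred0.
- exact: integer_pointsD.
- by move=> c a ic /iA ia j; rewrite mxE rpredM.
Qed.

End Combinations.

(** Here [a] and [b] are the square coordinates, [m] the square degree, [n] the degree and [z] the
    height. The bounds place [z] between the bottom of the interval for the smallest [j] and the top
    of the interval for the largest, so only gaps between consecutive intervals can fail. *)
Lemma no_gap_or_hole (h a b z m n : int) : 1 <= h ->
  0 <= a -> a <= m -> 0 <= b -> b <= m -> m <= n -> 0 <= z ->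
  (3 * h + 1) * (a + b - m) <= z ->
  z <= (3 * h + 1) * a + h * n -> z <= (3 * h + 1) * b + h * n ->
  (exists j : int, [/\ 0 <= j <= a, a + b - m <= j <= b
     & (3 * h + 1) * j <= z <= (3 * h + 1) * j + h * n]) \/
  [/\ a = 1, b = 1, m = 2, n = 2 & 2 * h < z < 3 * h + 1].
Proof.
move=> h1 a0 am b0 bm mn z0 zlo zhia zhib.
set k := 3 * h + 1 in zlo zhia zhib *.
set q := Num.max 0 (a + b - m).
set p := Num.min a b.
have q0 : 0 <= q by lia.
have qm : a + b - m <= q by lia.
have qp : q <= p by lia.
have [pa pb] : p <= a /\ p <= b by lia.
have kq : k * q <= z by rewrite /q; case: (leP 0 (a + b - m)); rewrite ?mulr0.
have kp : z <= k * p + h * n by rewrite /p; case: (leP a b).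
(* At or above [k * p], the last interval contains [z]. *)
have [kpz|zkp] := leP (k * p) z; first by left; exists p; split=> //; lia.
have [n3|n2] := leP 3 n.
  have k0 : 0 < k by lia.
  (* As [h * n >= 3 * h = k - 1], the interval starting at a multiple of [k] covers all integers
     before the next multiple. *)
  left; exists (z %/ k)%Z.
  have e := divz_eq z k.
  have r0 : 0 <= (z %% k)%Z by apply: modz_ge0; lia.
  have rk : (z %% k)%Z < k by apply: ltz_pmod.
  move: {+}(z %/ k)%Z {+}(z %% k)%Z e r0 rk => j r e r0 rk.
  have hn : 3 * h <= h * n by nia.
  have qj : q <= j by nia.
  have jp : j <= p by nia.
  split; nia.
(* Since [k * q <= z < k * p], the range of [j] has at least two elements; with [m <= n <= 2] this
   leaves only [a = b = 1]. *)
have qp1 : q < p by rewrite lt_neqAle qp andbT; apply/eqP => qpE; lia.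
have [a1 b1 m2 nn2] : [/\ a = 1, b = 1, m = 2 & n = 2] by split; lia.
have p1 : p = 1 by lia.
rewrite {}p1 in zkp.
have [zh|zh] := leP z (2 * h); last by right; split=> //; lia.
by left; exists 0; split; lia.
Qed.

(** * The polytope and the linear forms on its lift *)

Section Fibration.
Context {R : realType} (h m : nat).

Let ix : 'I_m.+3 := ord0.
Let iy : 'I_m.+3 := @Ordinal m.+3 1 isT.
Let iz : 'I_m.+3 := @Ordinal m.+3 2 isT.
Let k : R := 3 * h%:R + 1.

(* [None] stands for the base vertex [(1,1)] and [Some i] for the unit vector
   [e_i], except that [Some iz] stands for the origin, [iz] being the coordinate
   along the fibres. *)
Definition fiber_point (o : option 'I_m.+3) (s : R) : 'rV[R]_m.+3 :=
  \row_i (if i == iz then s + k * (o == None)%:R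
          else if o is Some j then (i == j)%:R else (i < 2)%N%:R).

Definition fibration_points : set 'rV[R]_m.+3 :=
  [set fiber_point u.1 (u.2 : nat)%:R
    | u in [set: option 'I_m.+3 * 'I_h.+1]].

Definition fibration := convex_hull fibration_points.

Definition height1 (y : 'rV[R]_m.+3) : 'rV[R]_(m.+3 + 1) :=
  row_mx y (const_mx 1).

Definition coor (i : 'I_m.+3) (x : 'rV[R]_(m.+3 + 1)) : R :=
  x ord0 (lshift 1 i).

Definition degree (x : 'rV[R]_(m.+3 + 1)) : R := x ord0 (rshift m.+3 ord0).

(* The number of summands lying over the square rather than over an apex. *)
Definition square_degree x : R := 
  degree x - \sum_(i < m.+3 | (2 < i)%N) coor i x.

Lemma coorD i x y : coor i (x + y) = coor i x + coor i y.
Proof. by rewrite /coor mxE. Qed.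

Lemma coorB i x y : coor i (x - y) = coor i x - coor i y.
Proof. by rewrite /coor !mxE. Qed.

Lemma coorZ i c x : coor i (c *: x) = c * coor i x.
Proof. by rewrite /coor mxE. Qed.

Lemma degreeD x y : degree (x + y) = degree x + degree y.
Proof. by rewrite /degree mxE. Qed.

Lemma degreeB x y : degree (x - y) = degree x - degree y.
Proof. by rewrite /degree !mxE. Qed.

Lemma degreeZ c x : degree (c *: x) = c * degree x.
Proof. by rewrite /degree mxE. Qed.

Lemma square_degreeD x y :
  square_degree (x + y) = square_degree x + square_degree y.
Proof.
rewrite /square_degree degreeD (eq_bigr _ (fun i _ => coorD i x y)) big_split.
by rewrite /=; ring.
Qed.

Lemma square_degreeZ c x : square_degree (c *: x) = c * square_degree x.
Proof.
rewrite /square_degree degreeZ (eq_bigr _ (fun i _ => coorZ i c x)).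
by rewrite -mulr_sumr mulrBr.
Qed.

Lemma square_degreeB x y :
  square_degree (x - y) = square_degree x - square_degree y.
Proof. by rewrite square_degreeD -scaleN1r square_degreeZ mulN1r. Qed.

Lemma eq_coor x y :
  (forall i, coor i x = coor i y) -> degree x = degree y -> x = y.
Proof.
move=> exy dxy; apply/rowP => i; rewrite -(splitK i).
by case: (split i) => j /=; [exact: exy | rewrite ord1; exact: dxy].
Qed.

Lemma coor_height1 i y : coor i (height1 y) = y ord0 i.
Proof. by rewrite /coor row_mxEl. Qed.

Lemma degree_height1 y : degree (height1 y) = 1.
Proof. by rewrite /degree row_mxEr mxE. Qed.

Lemma square_degree_fiber_point o s :
  square_degree (height1 (fiber_point o s)) =
  (if o is Some j then (j <= 2)%N else true)%:R.
Proof.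
rewrite /square_degree degree_height1.
have iz2 (i : 'I_m.+3) : (2 < i)%N -> (i == iz) = false.
  by move=> i2; apply/eqP => e; rewrite e in i2.
have -> : \sum_(i < m.+3 | (2 < i)%N) coor i (height1 (fiber_point o s)) =
    (if o is Some j then (2 < j)%N else false)%:R.
  transitivity (\sum_(i < m.+3 | (2 < i)%N)
      (if o is Some j then i == j else false)%:R : R).
    apply: eq_bigr => i i2; rewrite coor_height1 mxE iz2//.
    by case: o => // ; rewrite ltnNge ltnW.
  case: o => [j|]; last by rewrite big1.
  case: (boolP (2 < j)%N) => j2.
    rewrite (bigD1 j) //= eqxx big1 ?addr0 // => i /andP[_ /negPf ->] //.
  by rewrite big1 // => i i2; case: eqP => // e; rewrite -e i2 in j2.
case: o => [j|]; last by rewrite subr0.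
by rewrite ltnNge; case: (j <= 2)%N; rewrite /= ?subr0 ?subrr.
Qed.

(** Homogeneous inequalities for the cone over the polytope. With base coordinates a, b, square
    degree s and degree n, the height runs from k max(0, a+b-s) to k min(a, b) + hn; each extremum
    is split into two linear bounds. *)
Definition facets (x : 'rV[R]_(m.+3 + 1)) : Prop :=
  [/\ 0 <= coor ix x <= square_degree x,
      0 <= coor iy x <= square_degree x,
      0 <= coor iz x,
      k * (coor ix x + coor iy x - square_degree x) <= coor iz x &
      [/\ coor iz x <= k * coor ix x + h%:R * degree x,
          coor iz x <= k * coor iy x + h%:R * degree x &
          forall i : 'I_m.+3, (2 < i)%N -> 0 <= coor i x]].

Lemma facetsD x y : facets x -> facets y -> facets (x + y).
Proof.
move=> [/andP[? ?] /andP[? ?] ? ? [? ? xt]].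
move=> [/andP[? ?] /andP[? ?] ? ? [? ? yt]].
rewrite /facets square_degreeD degreeD !coorD.
split; [lra|lra|lra|lra|split; [lra|lra|]].
by move=> i i2; rewrite coorD addr_ge0 ?xt ?yt.
Qed.

Lemma facetsZ c x : 0 <= c -> facets x -> facets (c *: x).
Proof.
move=> c0 [/andP[x0 xm] /andP[y0 ym] z0 zlo [zx zy xt]].
rewrite /facets square_degreeZ degreeZ !coorZ.
split; last split.
- by rewrite mulr_ge0 // ler_wpM2l.
- by rewrite mulr_ge0 // ler_wpM2l.
- exact: mulr_ge0.
- by move/(ler_wpM2l c0): zlo; lra.
- by move/(ler_wpM2l c0): zx; lra.
- by move/(ler_wpM2l c0): zy; lra.
- by move=> i i2; rewrite coorZ mulr_ge0 ?xt.
Qed.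

Lemma facets0 : facets 0.
Proof.
(* Written as a multiple by 0, the zero vector is evaluated by homogeneity of the forms. *)
rewrite -(scale0r (0 : 'rV[R]_(m.+3 + 1))) /facets.
rewrite square_degreeZ degreeZ !coorZ !mul0r !mulr0 !addr0 subrr mulr0 lexx.
by split=> //; split=> // i _; rewrite coorZ mul0r.
Qed.

Lemma k_ge1 : 1 <= k.
Proof. by have := ler0n R h; rewrite /k; lra. Qed.

Lemma fiber_point_ge0 o (s : nat) i : 0 <= fiber_point o s%:R ord0 i.
Proof.
rewrite mxE; case: ifP => _; last by case: o => *; rewrite ler0n.
by rewrite addr_ge0 ?mulr_ge0 ?(le_trans ler01 k_ge1).
Qed.

Lemma facets_fiber_point o (s : nat) : (s <= h)%N ->
  facets (height1 (fiber_point o s%:R)).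
Proof.
rewrite -(ler_nat R) => sh; have s0 := ler0n R s; have k1 := k_ge1.
have tl : forall i : 'I_m.+3, (2 < i)%N ->
    0 <= coor i (height1 (fiber_point o s%:R)).
  by move=> i _; rewrite coor_height1 fiber_point_ge0.
move: tl; rewrite /facets square_degree_fiber_point degree_height1.
rewrite !coor_height1 !mxE !eqxx /=; case: o => [[j jm]|] /= tl; last first.
  rewrite !mulr1; split; rewrite ?ler01 ?lexx //; [lra|lra|].
  by split; [lra|lra|exact: tl].
rewrite -!val_eqE /=; case: j jm tl => [|[|[|j]]] jm tl /=;
  (split; [lra|lra|lra|lra|split; [lra|lra|exact: tl]]).
Qed.

Lemma integer_points_coor x : integer_points x <->
  (forall i, coor i x \is a Num.int) /\ degree x \is a Num.int.
Proof.
split=> [ix'|[ic idg] j]; first by split=> [i|]; apply: ix'.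
rewrite -(splitK j); case: (split j) => i /=; first exact: ic.
by rewrite (ord1 i); apply: idg.
Qed.

Lemma k_int : k \is a Num.int.
Proof. by rewrite /k -natrM natr1 rpred_nat. Qed.

Lemma integer_points_fiber_point o (s : nat) :
  integer_points (fiber_point o s%:R).
Proof.
move=> i; rewrite mxE; case: ifP => _; last by case: o => *; rewrite rpred_nat.
by rewrite rpredD ?rpredM ?rpred_nat ?k_int.
Qed.

Lemma lift_fibration_sub :
  lift_polytope fibration `<=` [set x | facets x /\ degree x = 1].
Proof.
have cF (x y : 'rV[R]_(m.+3 + 1)) (t : R) :
    facets x /\ degree x = 1 -> facets y /\ degree y = 1 -> 0 <= t <= 1 ->
    facets (t *: x + (1 - t) *: y) /\ degree (t *: x + (1 - t) *: y) = 1.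
  move=> [fx dx] [fy dy] /andP[t0 t1]; split.
    by apply: facetsD; apply: facetsZ => //; rewrite subr_ge0.
  by rewrite degreeD !degreeZ dx dy; ring.
apply: convex_hull_sub => // _ [y Py <-] /=.
(* The hull is taken twice, before and after lifting; since [height1] is affine, the same convex
   condition handles the inner hull. *)
apply: (_ : fibration `<=` [set y | facets (height1 y) /\
    degree (height1 y) = 1]) Py.
apply: convex_hull_sub => [u v t Fu Fv t01 /=|_ [[o s] _ <-] /=]; last first.
  split; last exact: degree_height1.
  by apply: facets_fiber_point; rewrite -ltnS.
have -> : height1 (t *: u + (1 - t) *: v) =
    t *: height1 u + (1 - t) *: height1 v; last exact: cF.
rewrite /height1 !scale_row_mx add_row_mx; congr row_mx.
by apply/rowP => i; rewrite !mxE; ring.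
Qed.

Lemma lattice_gens_fiber_point o (s : nat) : (s <= h)%N ->
  lattice_gens fibration (height1 (fiber_point o s%:R)).
Proof.
move=> sh; split.
  apply: sub_convex_hull; exists (fiber_point o s%:R) => //.
  apply: sub_convex_hull; rewrite -ltnS in sh.
  by exists (o, Ordinal sh).
apply/integer_points_coor; split=> [i|]; last by rewrite degree_height1.
by rewrite coor_height1; apply: integer_points_fiber_point.
Qed.

(* [j] counts the summands lying over [(1,1)]. *)
Definition gapless (x : 'rV[R]_(m.+3 + 1)) : Prop := exists j : int,
  [/\ 0 <= (j%:~R : R) <= coor ix x,
      coor ix x + coor iy x - square_degree x <= j%:~R <= coor iy x &
      k * j%:~R <= coor iz x <= k * j%:~R + h%:R * degree x].

Lemma gapless0 : gapless 0.
Proof.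
exists 0; rewrite -(scale0r (0 : 'rV[R]_(m.+3 + 1))).
rewrite square_degreeZ degreeZ !coorZ !mul0r !mulr0 !addr0 subrr.
by split; rewrite lexx.
Qed.

Lemma gaplessD x y : gapless x -> gapless y -> gapless (x + y).
Proof.
move=> [i [/andP[? ?] /andP[? ?] /andP[? ?]]].
move=> [j [/andP[? ?] /andP[? ?] /andP[? ?]]]; exists (i + j).
rewrite square_degreeD degreeD !coorD intrD; split; lra.
Qed.

(** For [t < h] the heights 2h+1+t are the integers strictly between 2h and k = 3h+1. *)
Definition hole_point (t : nat) : 'rV[R]_(m.+3 + 1) :=
  row_mx (\row_i (if i == iz then (2 * h + t).+1 else (i < 2)%N)%:R)
    (const_mx 2).

Lemma coor_hole_point i t : coor i (hole_point t) =
  (if i == iz then (2 * h + t).+1 else (i < 2)%N)%:R.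
Proof. by rewrite /coor row_mxEl mxE. Qed.

Lemma degree_hole_point t : degree (hole_point t) = 2.
Proof. by rewrite /degree row_mxEr mxE. Qed.

Lemma square_degree_hole_point t : square_degree (hole_point t) = 2.
Proof.
rewrite /square_degree degree_hole_point big1 ?subr0 // => i i2.
rewrite coor_hole_point; case: eqP => [e|_]; first by rewrite e in i2.
by rewrite ltnNge ltnW.
Qed.

(** * Integer points satisfying the inequalities: gapless points and holes *)

Lemma square_degree_le x : facets x -> square_degree x <= degree x.
Proof.
move=> [_ _ _ _ [_ _ xt]]; rewrite gerBl.
by apply: sumr_ge0 => i /xt.
Qed.

Lemma square_degree_int x : integer_points x -> square_degree x \is a Num.int.
Proof.
by move=> /integer_points_coor[ic idg]; rewrite rpredB // rpred_sum.
Qed.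

Lemma facets_gapless_or_hole x : (0 < h)%N -> integer_points x -> facets x ->
  gapless x \/ exists2 t, (t < h)%N & x = hole_point t.
Proof.
move=> h0 Zx Fx; have mn := square_degree_le Fx.
have sm := square_degree_int Zx.
have /integer_points_coor[ic idg] := Zx.
have [/andP[x0 xm] /andP[y0 ym] z0 zlo [zx zy xt]] := Fx.
have [a aE] := intrP (ic ix); have [b bE] := intrP (ic iy).
have [z zE] := intrP (ic iz); have [n nE] := intrP idg.
have [l lE] := intrP sm.
rewrite /k aE bE zE nE lE in mn x0 xm y0 ym z0 zlo zx zy.
have toR := (intrD, intrM, rmorphN, rmorph1).
have cst : h%:R = (h : int)%:~R :> R by rewrite pmulrn.
rewrite cst in zlo zx zy.
have h1 : 1 <= (h : int) by rewrite (lez_nat 1).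
have zlo' : (3 * h%:Z + 1) * (a + b - l) <= z.
  by rewrite -(ler_int R) !toR.
have zx' : z <= (3 * h%:Z + 1) * a + h%:Z * n by rewrite -(ler_int R) !toR.
have zy' : z <= (3 * h%:Z + 1) * b + h%:Z * n by rewrite -(ler_int R) !toR.
rewrite !(ler_int, ler0z) in mn x0 xm y0 ym z0.
have [[j [/andP[j0 ja] /andP[jl jb] /andP[jz zj]]]|[a1 b1 l2 n2 zh]] :=
  no_gap_or_hole h1 x0 xm y0 ym mn z0 zlo' zx' zy'.
  left; exists j; rewrite aE bE zE nE lE /k cst.
  rewrite -(ler_int R) !toR in jz; rewrite -(ler_int R) !toR in zj.
  rewrite -(ler_int R) !toR in jl.
  by rewrite ler0z !ler_int j0 ja jl jb jz zj.
right; case: z => [z|z] in zE z0 zlo zx zy zlo' zx' zy' zh *; last by lia.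
exists (z - (2 * h).+1)%N; first by lia.
apply: eq_coor => [i|]; last by rewrite degree_hole_point nE n2.
rewrite coor_hole_point; case: eqP => [->|/eqP iNz].
  by rewrite zE -pmulrn; congr _%:R; lia.
(* Square degree equals degree, so the nonnegative apex coordinates sum to 0. *)
have c0 : forall i : 'I_m.+3, (2 < i)%N -> coor i x = 0.
  have s0 : \sum_(i < m.+3 | (2 < i)%N) coor i x = 0.
    have : square_degree x = degree x by rewrite lE nE l2 n2.
    by rewrite /square_degree => e; lra.
  by move=> i' i2; move/psumr_eq0P: s0; apply.
case: i iNz => [[|[|[|i]]] im] // iNz.
- by rewrite (_ : Ordinal im = ix) ?aE ?a1 //; apply: val_inj.
- by rewrite (_ : Ordinal im = iy) ?bE ?b1 //; apply: val_inj.
- by rewrite c0.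
Qed.

(** The coordinate 1 along [ix] leaves [j = 0] or [j = 1]; the height is above 2h, too large for the
    former, and below k, too small for the latter. *)
Lemma hole_point_not_gapless t : (t < h)%N -> ~ gapless (hole_point t).
Proof.
move=> th [j []].
rewrite square_degree_hole_point degree_hole_point !coor_hole_point /=.
rewrite ler0z => /andP[j0 j1] _.
have {j0 j1} : j = 0 \/ j = 1 by rewrite (ler_int R _ 1) in j1; lia.
rewrite -(ltr_nat R) in th.
rewrite -natr1 natrD natrM /k.
have t0 := ler0n R t.
by case=> ->; rewrite ?mulr0 ?mulr1 => /andP[lo hi]; lra.
Qed.

(** By additivity only the generators matter. They have degree 1 while holes have degree 2, so the
    dichotomy makes them gapless without listing the lattice points of the polytope. *)
Lemma monoid_gens_gapless :
  (0 < h)%N -> monoid_gens fibration `<=` gapless.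
Proof.
move=> h0; apply: combinations_nat_sub => [||x [Lx Zx]].
- exact: gapless0.
- exact: gaplessD.
have [Fx dx] := lift_fibration_sub Lx.
have [//|[t _ xt]] := facets_gapless_or_hole h0 Zx Fx.
by move: dx; rewrite xt degree_hole_point => /eqP; rewrite (eqr_nat R 2 1).
Qed.

(** * Decomposition of gapless points into lattice points *)

Lemma split_nat_height (r : R) (n : nat) : r \is a Num.int ->
  0 <= r <= h%:R * n.+1%:R ->
  exists2 s, (s <= h)%N & 0 <= r - s%:R <= h%:R * n%:R.
Proof.
move=> Zr /andP[r0 rn]; have /natrP[p rE] : r \is a Num.nat.
  by rewrite natrEint Zr.
(* Greedy choice: either [r] is exhausted or a full [h] is removed. *)
rewrite rE in rn *; exists (minn p h); first exact: geq_minr.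
have hn : 0 <= h%:R * n%:R :> R by rewrite mulr_ge0.
rewrite -natr1 in rn.
have [ph|/ltnW hp] := leqP p h; first by rewrite subrr lexx.
by rewrite -(ler_nat R) in hp; rewrite subr_ge0 hp; lra.
Qed.


Lemma int_gt0_ge1 (r : R) : r \is a Num.int -> 0 < r -> 1 <= r.
Proof. by move=> /intrP[i ->]; rewrite ltr0z ler1z. Qed.

(* Peeling off one lattice point of the fibration at a time: the base vertex is
   chosen among those still occurring, and the fibre coordinate is taken as
   large as possible. *)
Lemma gapless_monoid_gens (n : nat) x : integer_points x -> gapless x ->
  (forall i : 'I_m.+3, (2 < i)%N -> 0 <= coor i x) -> degree x = n%:R ->
  monoid_gens fibration x.
Proof.
elim: n x => [|n IHn] x Zx [j [/andP[j0 ja] /andP[jl jb] /andP[jz zj]]] xt dx.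
  rewrite mulr0n in dx.
  (* In degree 0, the bounds on [j] give s >= a + b - j >= b >= 0, so the apex coordinates sum to at
     most 0. *)
  have s0 : \sum_(i < m.+3 | (2 < i)%N) coor i x = 0.
    apply/eqP; rewrite eq_le sumr_ge0 ?andbT => [|i /xt //].
    by rewrite /square_degree dx in jl; lra.
  have c0 : forall i : 'I_m.+3, (2 < i)%N -> coor i x = 0.
    by move=> i' i2; move/psumr_eq0P: s0; apply.
  have sd0 : square_degree x = 0 by rewrite /square_degree s0 dx subr0.
  rewrite sd0 in jl; rewrite dx mulr0 in zj.
  have jR0 : j%:~R = 0 :> R by lra.
  rewrite jR0 in ja jl jb jz zj.
  suff -> : x = 0 by apply: combinations0.
  apply: eq_coor => [i|]; last by rewrite dx /degree mxE.
  have -> : coor i 0 = 0 by rewrite /coor mxE.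
  case: (ltnP 2 i) => [/c0 //|]; case: i => [[|[|[|i]]] im] // _.
  - by rewrite (_ : Ordinal im = ix); [lra | apply: val_inj].
  - by rewrite (_ : Ordinal im = iy); [lra | apply: val_inj].
  - by rewrite (_ : Ordinal im = iz); [lra | apply: val_inj].
have [ic _] := (integer_points_coor x).1 Zx.
have [s sh /andP[rlo rhi]] : exists2 s, (s <= h)%N &
    0 <= (coor iz x - k * j%:~R) - s%:R <= h%:R * n%:R.
  apply: split_nat_height; first by rewrite rpredB ?rpredM ?k_int ?ic ?intr_int.
  by rewrite -dx; apply/andP; split; lra.
pose g o := height1 (fiber_point o s%:R).
(* It remains to choose a base vertex. Removing [None] lowers both [j] by 1 and the height by an
   extra [k], so the excess over [k * j] drops by [s] whatever the choice. *)
suff [o [jo lo bo to]] : exists o : option 'I_m.+3,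
  [/\ 0 <= (j%:~R - (o == None)%:R : R) <= coor ix (x - g o),
      coor ix (x - g o) + coor iy (x - g o) - square_degree (x - g o)
        <= j%:~R - (o == None)%:R,
      j%:~R - (o == None)%:R <= coor iy (x - g o) &
      forall i : 'I_m.+3, (2 < i)%N -> 0 <= coor i (x - g o)].
  have Lg : lattice_gens fibration (g o) by apply: lattice_gens_fiber_point.
  rewrite -(subrKC (g o) x) -[X in X + _]scale1r; apply: combinationsD.
    by apply: combinationsZ; rewrite //= rpred1.
  have Zg : integer_points (- g o) by move=> i; rewrite mxE rpredN; apply: Lg.2.
  have dg : degree (x - g o) = n%:R.
    by rewrite degreeB dx /g degree_height1 -natr1 addrK.
  apply: IHn => //; first exact: integer_pointsD.
  exists (j - (o == None)%:Z); rewrite dg intrB -pmulrn.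
  rewrite jo lo bo; split=> //.
  by rewrite coorB /g coor_height1 mxE eqxx; apply/andP; split; lra.
have oI i o : coor i (g o) = fiber_point o s%:R ord0 i by exact: coor_height1.
have oS o : square_degree (g o) =
    (if o is Some i then (i <= 2)%N else true)%:R.
  exact: square_degree_fiber_point.
(* An apex is removed first if one occurs: it has square degree 0 and leaves the bounds on [j]
   unchanged. *)
have [[l [l2 xl]]|xt0] :=
    pselect (exists l : 'I_m.+3, (2 < l)%N /\ 0 < coor l x).
  have nl : ((ix == l) = false) * ((iy == l) = false).
    by split; apply/eqP => e; rewrite -e in l2.
  exists (Some l).
  rewrite square_degreeB !coorB oS !oI !mxE /= leqNgt l2 !nl /= !subr0.
  split=> //; first by rewrite j0.
  move=> i i2; rewrite coorB oI mxE /=.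
  case: eqP => [e|_]; first by rewrite e in i2.
  case: eqP => [->|_]; last by rewrite subr0 xt.
  by rewrite subr_ge0 int_gt0_ge1.
have sdx : square_degree x = n.+1%:R.
  rewrite /square_degree dx big1 ?subr0 // => i i2.
  apply/eqP; rewrite eq_le xt // andbT leNgt; apply/negP => xi.
  by apply: xt0; exists i.
have n0 := ler0n R n; rewrite -natr1 in sdx; rewrite sdx in jl.
have tail (o : option 'I_m.+3) : (if o is Some l then (l <= 2)%N else true) ->
    forall i : 'I_m.+3, (2 < i)%N ->
      0 <= coor i (x - g o).
  move=> o2 i i2; rewrite coorB oI mxE.
  case: eqP => [e|_]; first by rewrite e in i2.
  case: o o2 => [l l2|_]; last by rewrite ltnNge ltnW // subr0 xt.
  case: eqP => [e|_]; last by rewrite subr0 xt.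
  by rewrite -e leqNgt i2 in l2.
(* If [j >= 1], both square coordinates are at least 1 and [(1,1)] can be removed. *)
have [j1|j1] := ltP 0 (j%:~R : R).
  have := int_gt0_ge1 (intr_int _ _) j1 => {}j1.
  exists None; split; last exact: tail;
    by rewrite ?square_degreeB !coorB ?oS !oI !mxE /=; lra.
have jR0 : j%:~R = 0 :> R by lra.
rewrite jR0 in ja jl jb *.
have [/(int_gt0_ge1 (ic _)) a1|a1] := ltP 0 (coor ix x).
  exists (Some ix); split; last exact: tail;
    by rewrite ?square_degreeB !coorB ?oS !oI !mxE /=; lra.
have [/(int_gt0_ge1 (ic _)) b1|b1] := ltP 0 (coor iy x).
  exists (Some iy); split; last exact: tail;
    by rewrite ?square_degreeB !coorB ?oS !oI !mxE /=; lra.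
(* Now a = b = j = 0, and removing the origin leaves square degree [n >= 0]. *)
exists (Some iz); split; last exact: tail;
  by rewrite ?square_degreeB !coorB ?oS !oI !mxE /=; lra.
Qed.

(** * The cone, the group and the exact set of holes *)

Lemma cone_gens_facets : cone_gens fibration `<=` facets.
Proof.
apply: combinations_ind => [||c x c0 [/lift_fibration_sub[Fx _] _]].
- exact: facets0.
- exact: facetsD.
- exact: facetsZ.
Qed.

(** Over the base, (1,1) + (0,0) = (1,0) + (0,1), with bottom heights k and 0 on the two sides.
    Mixing the two sums with weights l and 1 - l reaches every height l k in between. *)
Lemma hole_point_cone_gens t : (t < h)%N -> cone_gens fibration (hole_point t).
Proof.
move=> th; have k0 : 0 < k := lt_le_trans ltr01 k_ge1.
pose z : R := (2 * h + t).+1%:R; pose l := z / k.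
have l0 : 0 <= l by rewrite divr_ge0 ?ler0n // ltW.
have l1 : 0 <= 1 - l.
  rewrite subr_ge0 ler_pdivrMr // mul1r /k -natrM natr1 ler_nat; lia.
have lk : l * k = z by rewrite /l divfK ?gt_eqF.
pose g o := height1 (fiber_point o 0%:R).
have cg c o : 0 <= c -> cone_gens fibration (c *: g o).
  by move=> c0; apply: combinationsZ => //; apply: lattice_gens_fiber_point.
suff -> : hole_point t = l *: g None + l *: g (Some iz)
    + ((1 - l) *: g (Some ix) + (1 - l) *: g (Some iy)).
  by do !apply: combinationsD; apply: cg.
apply: eq_coor => [i|]; last first.
  by rewrite degree_hole_point !degreeD !degreeZ !degree_height1; ring.
rewrite coor_hole_point !coorD !coorZ !coor_height1 !mxE.
have [_|iz'] /= := eqVneq i iz; first by rewrite -/z -lk; ring.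
by case: i iz' => [[|[|[|i]]] im] // iz'; rewrite -?val_eqE /=; ring.
Qed.

(** Since [h >= 1], the points at heights 1 and 0 over the origin differ by the vertical unit
    vector, which lifts e_x + e_y to any integer height. *)
Lemma hole_point_group_gens t :
  (t < h)%N -> group_gens fibration (hole_point t).
Proof.
move=> th; pose z : R := (2 * h + t).+1%:R.
pose g o (s : nat) := height1 (fiber_point o s%:R).
have cg c o s : c \is a Num.int -> (s <= h)%N ->
      group_gens fibration (c *: g o s).
  by move=> ci sh; apply: combinationsZ => //; apply: lattice_gens_fiber_point.
suff -> : hole_point t = 1 *: g (Some ix) 0%N + 1 *: g (Some iy) 0%N
    + (z *: g (Some iz) 1%N + (- z) *: g (Some iz) 0%N).
  by do !apply: combinationsD; apply: cg => //;
    rewrite ?rpredN ?rpred1 ?rpred_nat // (leq_trans _ th).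
apply: eq_coor => [i|]; last first.
  by rewrite degree_hole_point !degreeD !degreeZ !degree_height1; ring.
rewrite coor_hole_point !coorD !coorZ !coor_height1 !mxE.
have [_|iz'] /= := eqVneq i iz; first by rewrite -/z; ring.
by case: i iz' => [[|[|[|i]]] im] // iz'; rewrite -?val_eqE /=; ring.
Qed.

Lemma holes_fibration : (0 < h)%N -> holes fibration = hole_point @` `I_h.
Proof.
move=> h0; apply/seteqP; split=> [x [[Cx Gx] nMx]|_ [t /= th <-]]; last first.
  split; first split.
  - exact: hole_point_cone_gens.
  - exact: hole_point_group_gens.
  - by move=> /(monoid_gens_gapless h0); apply: hole_point_not_gapless.
have Fx := cone_gens_facets Cx.
have Zx : integer_points x by apply: combinations_int_sub Gx => y [].
have [gx|[t th ->]] := facets_gapless_or_hole h0 Zx Fx; last by exists t.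
have [_ _ _ _ [_ _ xt]] := Fx.
(* From 0 <= [coor ix x] <= square degree <= degree, the degree is a natural number, as the
   induction in the decomposition requires. *)
have d0 : 0 <= degree x.
  have [/andP[? ?] _ _ _ _] := Fx.
  by rewrite (le_trans _ (square_degree_le Fx)) //; lra.
have /natrP[n dn] : degree x \is a Num.nat.
  by rewrite natrEint d0 andbT; case/integer_points_coor: Zx.
by case: nMx; apply: gapless_monoid_gens dn.
Qed.

Lemma hole_point_inj : injective hole_point.
Proof.
move=> s t /(congr1 (coor iz)); rewrite !coor_hole_point eqxx.
by move/eqP; rewrite eqr_nat eqSS eqn_add2l => /eqP.
Qed.

(** * Integrality, dimension and conclusion *)

Lemma integral_fibration : integral_convex_polytope fibration.
Proof.
split.
  exists fibration_points; split=> //.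
  by apply: finite_image; apply: finite_finset.
move=> x /vertices_convex_hull [[o s] _ <-].
exact: integer_points_fiber_point.
Qed.

Lemma has_dimension_fibration : (0 < h)%N -> has_dimension fibration m.+3.
Proof.
move=> h0; have inF o (s : nat) : (s <= h)%N -> fibration (fiber_point o s%:R).
  move=> sh; apply: sub_convex_hull; rewrite -ltnS in sh.
  by exists (o, Ordinal sh).
have F0 : fibration 0.
  have -> : 0 = fiber_point (Some iz) 0%:R; last exact: inF.
  by apply/rowP => i; rewrite !mxE; case: eqP => _; rewrite ?mulr0 ?addr0.
have Fe j : fibration (delta_mx 0 j).
  (* The unit vector along the fibre is the point at height 1 over the origin, available because
     [h >= 1]. *)
  have -> : delta_mx 0 j = fiber_point (Some j) (j == iz)%:R.
    apply/rowP => i; rewrite !mxE /= mulr0 addr0.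
    by case: (i =P iz) => [->|//]; rewrite eq_sym.
  by apply: inF; case: (j == iz).
exists 0, fullv; split; first by rewrite dimvf; exact: mul1n.
apply/seteqP; split=> [x _ /=|x _]; first by exists x; rewrite ?memvf ?add0r.
(* Index 0 carries the origin, whose coefficient absorbs what is missing to total 1. *)
exists m.+4,
  (fun i => if unlift ord0 i is Some j then delta_mx 0 j else 0),
  (fun i => if unlift ord0 i is Some j then x 0 j else 1 - \sum_j x 0 j).
split=> [i||].
- by case: unlift.
- rewrite big_ord_recl unlift_none [X in _ + X](eq_bigr (x 0)) ?subrK // => j _.
  by rewrite liftK.
- rewrite big_ord_recl unlift_none scaler0 add0r {1}[x]row_sum_delta.
  by apply: eq_bigr => j _; rewrite liftK.
Qed.

End Fibration.

Theorem theorem0p1 (R : realType) (h d : nat) (h_ge1 : (1 <= h)%N)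
    (d_ge3 : (3 <= d)%N) :
  exists (N : nat) (P : set 'rV[R]_N),
    [/\ integral_convex_polytope P,
        has_dimension P d,
        very_ample P,
        ~ normal_polytope P
      & (holes P #= `I_h)%card].
Proof.
case: d d_ge3 => [|[|[|m]]] // _; exists m.+3, (@fibration R h m).
have hE := @holes_fibration R h m h_ge1.
split; [exact: integral_fibration|exact: has_dimension_fibration| | |].
- by rewrite /very_ample hE; apply: finite_image.
- move=> nP; have : holes (@fibration R h m) (@hole_point R h m 0).
    by rewrite hE; exists 0%N.
  by rewrite /holes nP setDv.
- by rewrite hE; apply: inj_card_eq => s t _ _; apply: hole_point_inj.
Qed.
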